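(* Let $R$ be a ring and $G$ a group. Let $\{N_1, N_2, \ldots, N_k\}$ be a collection of ideals of $R$ satisfying the CNC-condition, with $s_i$ being the characteristic of the ideal $N_i$ in the ideal $N_{i+1}$. Then $f+N_1G$ is an invertible element in the group ring $(R/N_1)G$ if and only if $f+N_1G\subset (RG)^{\ast}$. Furthermore, for $x\in f+N_1G$, \[x^{-1}=g(xg)^{s_1s_2\cdots s_{k-1}-1},\] where $g\in RG$ is such that $(f+N_1G)(g+N_1G)=1+N_1G$. Moreover, $|(RG)^{\ast}|=|N_1|^{|G|}\,|((R/N_1)G)^{\ast}|$.
   Context: Rings are associative with identity $1$, not necessarily commutative. For a ring $A$, $A^{\ast}$ denotes its group of invertible elements. $RG$ is the group ring, $f$ denotes an element of $RG$, and for an ideal $N$ of $R$, $NG$ is the ideal of $RG$ consisting of the elements with all coefficients in $N$. The ring $RG/N_1G$ is identified with $(R/N_1)G$ by reducing coefficients modulo $N_1$. A collection $\{N_1,\dots,N_k\}$ of ideals of a ring $R$ satisfies the CNC-condition if: (1) (chain condition) $\{0\}=N_k\subset N_{k-1}\subset\cdots\subset N_2\subset N_1\subset R$; (2) (nilpotency condition) for $i=1,\dots,k-1$ there exists $t_i\geq 2$ such that $N_i^{t_i}\subset N_{i+1}$; (3) (characteristic condition) for $i=1,\dots,k-1$ there exists $s_i\geq 1$ such that $s_iN_i\subset N_{i+1}$; in addition, the prime factors of $s_i$ are greater than or equal to $t_i$. The minimum number $t_i$ satisfying the nilpotency condition is called the nilpotency index of $N_i$ in $N_{i+1}$; the minimum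 number $s_i$ satisfying the characteristic condition is called the characteristic of $N_i$ in $N_{i+1}$.
   Formalization: The formula |(RG)*| = |N_1|^|G| |((R/N_1)G)*| is proved for finite G only; it fails for R = Z/4, N_1 = 2Z/4, N_2 = 0, G = Z (countable versus uncountable). For arbitrary G it is proved with |N_1G| in place of |N_1|^|G|. *)

(* Defs.v *)
From HB Require Import structures.
From mathcomp Require Import all_boot all_order all_algebra.
From mathcomp Require Import finmap.
From mathcomp Require Import monalg.
From mathcomp Require Import boolp classical_sets functions cardinality.

Set Implicit Arguments.
Unset Strict Implicit.
Unset Printing Implicit Defensive.

Import GRing.Theory.

Local Open Scope classical_set_scope.
Local Open Scope ring_scope.

(* MathComp's [idealr] is one-sided and proper, over a nonzero ring, hence
   this structure. *)
HB.mixin Record isTwoSidedIdeal (R : pzRingType) (S : R -> bool) := {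
  ideal_mull : forall a u, u \in S -> a * u \in S;
  ideal_mulr : forall a u, u \in S -> u * a \in S
}.

#[short(type="twoSidedIdeal")]
HB.structure Definition TwoSidedIdeal (R : pzRingType) :=
  {S of GRing.ZmodClosed R S & isTwoSidedIdeal R S}.

(* MathComp makes [{quot I}] an additive group for every R, but a ring only
   when R is commutative. *)
Section QuotientRing.
Variables (R : pzRingType) (I : twoSidedIdeal R).

Definition quot_ring := Quotient.quot I.

HB.instance Definition _ := Choice.on quot_ring.
HB.instance Definition _ := GRing.Zmodule.on quot_ring.

Definition quot_pi (a : R) : quot_ring := \pi_(Quotient.quot I)%qT a.

Lemma quot_piE a b : (quot_pi a == quot_pi b) = (a - b \in I).
Proof. by rewrite /quot_pi -Quotient.idealrBE. Qed.

Lemma quot_pi_surj (q : quot_ring) : exists a, quot_pi a = q.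
Proof.
by exists (generic_quotient.repr q); rewrite /quot_pi generic_quotient.reprK.
Qed.

Lemma quot_piB : {morph quot_pi : a b / a - b}.
Proof. by move=> a b; rewrite /quot_pi raddfB. Qed.

Lemma quot_piD : {morph quot_pi : a b / a + b}.
Proof. by move=> a b; rewrite /quot_pi raddfD. Qed.

HB.instance Definition _ :=
  GRing.isZmodMorphism.Build R quot_ring quot_pi quot_piB.

Definition quot_one : quot_ring := quot_pi 1.
Definition quot_mul (p q : quot_ring) : quot_ring :=
  quot_pi (generic_quotient.repr p * generic_quotient.repr q).

Lemma quot_piM a b : quot_pi (a * b) = quot_mul (quot_pi a) (quot_pi b).
Proof.
apply/eqP; rewrite quot_piE.
set a' := generic_quotient.repr _; set b' := generic_quotient.repr _.
have Ha : a - a' \in I by rewrite -quot_piE /quot_pi generic_quotient.reprK.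
have Hb : b - b' \in I by rewrite -quot_piE /quot_pi generic_quotient.reprK.
have -> : a * b - a' * b' = (a - a') * b + a' * (b - b').
  by rewrite mulrBl mulrBr addrA subrK.
by apply: rpredD; [exact: ideal_mulr | exact: ideal_mull].
Qed.

Lemma quot_mulA : associative quot_mul.
Proof.
move=> p q r.
have [a <-] := quot_pi_surj p; have [b <-] := quot_pi_surj q.
by have [c <-] := quot_pi_surj r; rewrite -!quot_piM mulrA.
Qed.

Lemma quot_mul1q : left_id quot_one quot_mul.
Proof. by move=> q; have [a <-] := quot_pi_surj q; rewrite -quot_piM mul1r. Qed.

Lemma quot_mulq1 : right_id quot_one quot_mul.
Proof. by move=> q; have [a <-] := quot_pi_surj q; rewrite -quot_piM mulr1. Qed.

Lemma quot_mulDl : left_distributive quot_mul +%R.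
Proof.
move=> p q r.
have [a <-] := quot_pi_surj p; have [b <-] := quot_pi_surj q.
by have [c <-] := quot_pi_surj r; rewrite -quot_piD -!quot_piM mulrDl quot_piD.
Qed.

Lemma quot_mulDr : right_distributive quot_mul +%R.
Proof.
move=> p q r.
have [a <-] := quot_pi_surj p; have [b <-] := quot_pi_surj q.
by have [c <-] := quot_pi_surj r; rewrite -quot_piD -!quot_piM mulrDr quot_piD.
Qed.

HB.instance Definition _ := GRing.Zmodule_isPzRing.Build quot_ring
  quot_mulA quot_mul1q quot_mulq1 quot_mulDl quot_mulDr.

Lemma quot_pi_monoid : monoid_morphism quot_pi.
Proof. by split=> // a b; rewrite quot_piM. Qed.

HB.instance Definition _ :=
  GRing.isMonoidMorphism.Build R quot_ring quot_pi quot_pi_monoid.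

End QuotientRing.

(* The additive group of finitely supported functions comes from [monalg],
   whose ring structure on it excludes monoids with nontrivial units. *)
Section GroupRing.
Variables (R : pzRingType) (G : groupType).

Definition group_ring := {malg R[G]}.

HB.instance Definition _ := Choice.on group_ring.
HB.instance Definition _ := GRing.Zmodule.on group_ring.

Definition gr_one : group_ring := << 1 *g 1%g >>.
Definition gr_mul (x y : group_ring) : group_ring :=
  \sum_(h <- msupp x) \sum_(k <- msupp y) << x@_h * y@_k *g (h * k)%g >>.

Lemma gr_mulw (d1 d2 : {fset G}) (x y : group_ring) :
  (msupp x `<=` d1)%fset -> (msupp y `<=` d2)%fset ->
  gr_mul x y = \sum_(h <- d1) \sum_(k <- d2) << x@_h * y@_k *g (h * k)%g >>.
Proof.
move=> le1 le2; rewrite /gr_mul (big_fset_incl _ le1) /=.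
  apply/eq_bigr=> h _; apply/big_fset_incl => // k _ /mcoeff_outdom ->.
  by rewrite mulr0 monalgU0.
move=> h _ /mcoeff_outdom xh.
by rewrite big1 // => k _; rewrite xh mul0r monalgU0.
Qed.

Lemma gr_mulDl : left_distributive gr_mul +%R.
Proof.
move=> x y z.
rewrite (gr_mulw (msuppD_le x y) (fsubset_refl _)).
rewrite (gr_mulw (fsubsetUl (msupp x) (msupp y)) (fsubset_refl (msupp z))).
rewrite (gr_mulw (fsubsetUr (msupp x) (msupp y)) (fsubset_refl (msupp z))).
rewrite -big_split; apply: eq_bigr => h _; rewrite -big_split.
by apply: eq_bigr => k _; rewrite mcoeffD mulrDl monalgUD.
Qed.

Lemma gr_mulDr : right_distributive gr_mul +%R.
Proof.
move=> z x y.
rewrite (gr_mulw (fsubset_refl _) (msuppD_le x y)).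
rewrite (gr_mulw (fsubset_refl (msupp z)) (fsubsetUl (msupp x) (msupp y))).
rewrite (gr_mulw (fsubset_refl (msupp z)) (fsubsetUr (msupp x) (msupp y))).
rewrite -big_split; apply: eq_bigr => h _; rewrite -big_split.
by apply: eq_bigr => k _; rewrite mcoeffD mulrDr monalgUD.
Qed.

Lemma gr_mul0 x : gr_mul 0 x = 0.
Proof. by apply: (addrI (gr_mul 0 x)); rewrite -gr_mulDl !addr0. Qed.

Lemma gr_mulr0 x : gr_mul x 0 = 0.
Proof. by apply: (addrI (gr_mul x 0)); rewrite -gr_mulDr !addr0. Qed.

Lemma gr_mulUU a b (h k : G) :
  gr_mul << a *g h >> << b *g k >> = << a * b *g (h * k)%g >>.
Proof. by rewrite (gr_mulw msuppU_le msuppU_le) !big_seq_fset1 !mcoeffUU. Qed.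

Lemma gr_mul_suml I (r : seq I) (F : I -> group_ring) y :
  gr_mul (\sum_(i <- r) F i) y = \sum_(i <- r) gr_mul (F i) y.
Proof.
exact: (big_morph (gr_mul^~ y) (fun _ _ => gr_mulDl _ _ _) (gr_mul0 y)).
Qed.

Lemma gr_mul_sumr I (r : seq I) (F : I -> group_ring) y :
  gr_mul y (\sum_(i <- r) F i) = \sum_(i <- r) gr_mul y (F i).
Proof.
exact: (big_morph (gr_mul y) (fun _ _ => gr_mulDr _ _ _) (gr_mulr0 y)).
Qed.

Lemma gr_mulA : associative gr_mul.
Proof.
move=> x y z; rewrite [x]monalgE [y]monalgE [z]monalgE.
rewrite !(gr_mul_suml (msupp x)); apply: eq_bigr => h _.
rewrite (gr_mul_suml (msupp y)) !(gr_mul_sumr (msupp y)) gr_mul_suml.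
apply: eq_bigr => k _; rewrite !(gr_mul_sumr (msupp z)); apply: eq_bigr => l _.
by rewrite !gr_mulUU mulrA mulgA.
Qed.

Lemma gr_mul1x : left_id gr_one gr_mul.
Proof.
move=> x; rewrite [x in LHS]monalgE gr_mul_sumr [RHS]monalgE.
by apply: eq_bigr => h _; rewrite gr_mulUU mul1r mul1g.
Qed.

Lemma gr_mulx1 : right_id gr_one gr_mul.
Proof.
move=> x; rewrite [x in LHS]monalgE gr_mul_suml [RHS]monalgE.
by apply: eq_bigr => h _; rewrite gr_mulUU mulr1 mulg1.
Qed.

HB.instance Definition _ := GRing.Zmodule_isPzRing.Build group_ring
  gr_mulA gr_mul1x gr_mulx1 gr_mulDl gr_mulDr.

End GroupRing.

Section Reduction.
Variables (R : pzRingType) (G : groupType) (I : twoSidedIdeal R).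

(* The ideal IG of RG. *)
Definition coef_ideal : set (group_ring R G) :=
  [set x | forall h, x@_h \in I].

Definition coef_coset (f : group_ring R G) : set (group_ring R G) :=
  [set f + n | n in coef_ideal].

Definition reduce (x : group_ring R G) : group_ring (quot_ring I) G :=
  [malg h in msupp x => quot_pi I x@_h].

Lemma reduceE x h : (reduce x)@_h = quot_pi I x@_h.
Proof. by rewrite mcoeffE; case: msuppP; rewrite ?raddf0. Qed.

Lemma reduce_eq x y : (reduce x = reduce y) <-> coef_ideal (x - y).
Proof.
split=> [exy h|xyI].
  by rewrite mcoeffB -quot_piE -!reduceE exy.
apply/malgP => h; rewrite !reduceE; apply/eqP.
by rewrite quot_piE -mcoeffB xyI.
Qed.

Lemma reduce_surj (q : group_ring (quot_ring I) G) : exists x, reduce x = q.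
Proof.
pose x : group_ring R G := [malg h in msupp q => generic_quotient.repr q@_h].
exists x; apply/malgP => h; rewrite reduceE mcoeffE.
by case: msuppP => _; rewrite ?raddf0 // /quot_pi generic_quotient.reprK.
Qed.

Lemma reduceB : zmod_morphism reduce.
Proof. by move=> x y; apply/malgP=> h; rewrite !(reduceE, mcoeffB) raddfB. Qed.

HB.instance Definition _ :=
  GRing.isZmodMorphism.Build (group_ring R G) (group_ring (quot_ring I) G)
    reduce reduceB.

Lemma reduceU a (h : G) : reduce << a *g h >> = << quot_pi I a *g h >>.
Proof. by apply/malgP=> k; rewrite reduceE !mcoeffU raddfMn. Qed.

Lemma reduce_monoid : monoid_morphism reduce.
Proof.
split=> [|x y]; first exact: reduceU.
have -> : x * y = gr_mul x y by [].
have -> : reduce x * reduce y = gr_mul (reduce x) (reduce y) by [].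
rewrite [x]monalgE [y]monalgE gr_mul_suml !raddf_sum gr_mul_suml.
apply: eq_bigr => h _; rewrite !gr_mul_sumr raddf_sum.
by apply: eq_bigr => k _; rewrite gr_mulUU /= !reduceU gr_mulUU rmorphM.
Qed.

HB.instance Definition _ :=
  GRing.isMonoidMorphism.Build (group_ring R G) (group_ring (quot_ring I) G)
    reduce reduce_monoid.

End Reduction.

Definition is_inverse (A : pzRingType) (x y : A) := x * y = 1 /\ y * x = 1.

Definition units (A : pzRingType) : set A := [set x | exists y, is_inverse x y].
Arguments units A : clear implicits.

Section CNC.
Variable R : pzRingType.
Implicit Types I J : twoSidedIdeal R.

(* I^t: the finite sums of products of t elements of I. *)
Definition ideal_pow I (t : nat) : set R :=
  [set a | exists2 u : seq (t.-tuple R),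
     all (fun w : t.-tuple R => all [in I] w) u &
     a = \sum_(w <- u) \prod_(b <- w) b].

Definition nilpotency_condition I J (t : nat) : Prop :=
  (2 <= t)%N /\ ideal_pow I t `<=` [set` J].

Definition characteristic_condition I J (t s : nat) : Prop :=
  [/\ (1 <= s)%N, [set a *+ s | a in [set` I]] `<=` [set` J]
    & forall p, prime p -> (p %| s)%N -> (t <= p)%N].

(* The characteristic of I in J, where t is an exponent with I^t included in
   J; it depends on t only through the condition on prime factors. *)
Definition is_characteristic I J (t s : nat) : Prop :=
  characteristic_condition I J t s /\
  forall s', characteristic_condition I J t s' -> (s <= s')%N.

(* Only N 1, ..., N k and t 1, ..., t k.-1 matter. *)
Definition CNC (k : nat) (N : nat -> twoSidedIdeal R) (t : nat -> nat) : Prop :=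
  [/\ (1 <= k)%N,
      [set` N k] = [set 0] /\
        (forall i, (1 <= i < k)%N -> [set` N i.+1] `<=` [set` N i]),
      forall i, (1 <= i < k)%N -> nilpotency_condition (N i) (N i.+1) (t i)
    & forall i, (1 <= i < k)%N ->
        exists s, characteristic_condition (N i) (N i.+1) (t i) s].

End CNC.

(* Main.v *)
Require Import Defs.
From HB Require Import structures.
From mathcomp Require Import all_boot all_order all_algebra.
From mathcomp Require Import finmap.
From mathcomp Require Import monalg.
From mathcomp Require Import boolp classical_sets functions cardinality.

(** Write [S] for the product of the [s i].  The whole statement comes from
    one identity: [a ^+ S = 1] for every [a] congruent to 1 modulo [N_1 G].

    Going down the chain, it is enough to see that raising to the power [s i]
    takes [1 + N_i G] into [1 + N_(i+1) G] ([coef_ideal_expr]).  Modulo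
    [N_(i+1) G] such an element is [1 + m] with [m ^+ t = 0] and
    [m *+ s = 0], where [t] and [s] are the exponent and the characteristic
    of this step.  In the binomial expansion of [(1 + m) ^+ s], the terms of
    degree at least [t] vanish by nilpotency.  In the terms of degree
    [0 < j < t], [j] is prime to [s], because no prime factor of [s] is
    below [t]; so [s] divides ['C(s, j)] and the term is killed by the
    characteristic ([nilp_expr1D]).

    If [g] lifts an inverse of [f] modulo [N_1 G] and [x] lies in
    [f + N_1 G], then [x * g] and [g * x] are both congruent to 1, so their
    [S]-th powers are 1, and [g * (x * g) ^+ (S - 1)] is a two-sided inverse
    of [x].  Hence the units of [RG] are exactly the preimage of the units of
    [(R/N_1)G], and the cardinality formula counts this preimage fibre by
    fibre, each fibre being a translate of the kernel [N_1 G]. *)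

Set Implicit Arguments.
Unset Strict Implicit.
Unset Printing Implicit Defensive.

Import GRing.Theory.

Local Open Scope classical_set_scope.
Local Open Scope card_scope.
Local Open Scope ring_scope.

(** Since [j * 'C(s, j) = s * 'C(s.-1, j.-1)], it suffices that [j] be prime
    to [s]; a common prime factor would be both at least [t] and at most
    [j]. *)
Lemma dvdn_bin_small (s t j : nat) :
  (forall p, prime p -> (p %| s)%N -> (t <= p)%N) ->
  (0 < j < t)%N -> (s %| 'C(s, j))%N.
Proof.
move=> pdivs /andP[j_gt0 ltjt].
have cop_sj : coprime s j.
  apply: contraT => ncop; have gcd_gt1 : (1 < gcdn s j)%N.
    by rewrite ltn_neqAle eq_sym ncop gcdn_gt0 j_gt0 orbT.
  have pr_p := pdiv_prime gcd_gt1.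
  have letp := pdivs _ pr_p (dvdn_trans (pdiv_dvd _) (dvdn_gcdl s j)).
  have /(dvdn_leq j_gt0) lepj := dvdn_trans (pdiv_dvd _) (dvdn_gcdr s j).
  by have := leq_ltn_trans lepj ltjt; rewrite ltnNge letp.
rewrite -(Gauss_dvdr _ cop_sj).
by case: j {cop_sj ltjt} j_gt0 => // j _; rewrite -mul_bin_diag dvdn_mulr.
Qed.

(** A binomial term of degree [j >= t] contains [m ^+ t]; one of degree
    [0 < j < t] contains [m *+ s], because [s] divides its coefficient. *)
Lemma nilp_expr1D (A : pzRingType) (m : A) (s t : nat) :
  m ^+ t = 0 -> m *+ s = 0 ->
  (forall p, prime p -> (p %| s)%N -> (t <= p)%N) -> (1 + m) ^+ s = 1.
Proof.
move=> mt0 ms0 pdivs; rewrite addrC exprD1n big_ord_recl expr0 bin0 mulr1n.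
rewrite big1 ?addr0 // => i _; rewrite lift0.
have [ltit|leti] := ltnP i.+1 t; last first.
  by rewrite -(subnK leti) exprD mt0 mulr0 mul0rn.
have /dvdnP[c ->] : (s %| 'C(s, i.+1))%N by apply: dvdn_bin_small pdivs _.
by rewrite mulnC mulrnA exprS -mulrnAl ms0 mul0r mul0rn.
Qed.

Lemma is_inverse_expr (A : pzRingType) (x g : A) (S : nat) :
  (0 < S)%N -> (x * g) ^+ S = 1 -> (g * x) ^+ S = 1 ->
  is_inverse x (g * (x * g) ^+ (S - 1)).
Proof.
case: S => // n _ xgn gxn; rewrite subn1 /=; split.
  by rewrite mulrA -exprS.
(* Shifting the bracketing turns (x g)^n into (g x)^n. *)
suff -> : g * (x * g) ^+ n = (g * x) ^+ n * g by rewrite -mulrA -exprSr.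
elim: n {xgn gxn} => [|n IHn]; first by rewrite !expr0 mulr1 mul1r.
by rewrite exprSr mulrA IHn exprSr -!mulrA.
Qed.

Section CoefIdeal.
Variables (R : pzRingType) (G : groupType).
Implicit Types (I J : twoSidedIdeal R) (x y : group_ring R G).

Lemma coef_idealP I x : coef_ideal I x <-> reduce I x = 0.
Proof. by have := reduce_eq I x 0; rewrite raddf0 subr0 => <-. Qed.

Lemma ideal_powD I n a b :
  ideal_pow I n a -> ideal_pow I n b -> ideal_pow I n (a + b).
Proof.
move=> [u uI ->] [v vI ->]; exists (u ++ v); first by rewrite all_cat uI.
by rewrite big_cat.
Qed.

Lemma ideal_pow0 I n : ideal_pow I n 0.
Proof. by exists [::]; rewrite ?big_nil. Qed.

Lemma ideal_powM I n a b :
  ideal_pow I n a -> b \in I -> ideal_pow I n.+1 (a * b).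
Proof.
move=> [u uI ->] bI.
exists [seq [tuple of rcons w b] | w : n.-tuple R <- u].
  rewrite all_map; apply/allP => w /(allP uI) /= wI.
  by rewrite all_rcons bI.
by rewrite big_map mulr_suml; apply: eq_bigr => w _; rewrite big_rcons.
Qed.

(** The ideal power is taken in [R], the power of [x] in [RG]: each
    coefficient of [x ^+ n] is a sum of products of [n] coefficients. *)
Lemma mcoeff_expr I x n h : coef_ideal I x -> ideal_pow I n (x ^+ n)@_h.
Proof.
move=> xI; elim: n h => [|n IHn] h.
  rewrite expr0 [1]/(<< 1 *g 1%g >>) mcoeffU.
  case: eqP => _; last exact: ideal_pow0.
  by exists [:: [tuple]]; rewrite ?big_seq1 ?big_nil.
rewrite exprSr [_ * _]/(gr_mul _ _) /gr_mul raddf_sum /=.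
apply: (big_ind (ideal_pow I n.+1)); [exact: ideal_pow0|exact: ideal_powD|].
move=> k _; rewrite raddf_sum /=.
apply: (big_ind (ideal_pow I n.+1)); [exact: ideal_pow0|exact: ideal_powD|].
move=> l _; rewrite mcoeffU; case: eqP => _; last exact: ideal_pow0.
exact: ideal_powM.
Qed.

(** Read in [(R/J)G], the two conditions become the equations
    [m ^+ t = 0] and [m *+ s = 0] for the image [m] of [x - 1]. *)
Lemma coef_ideal_expr I J (t s : nat) x :
  nilpotency_condition I J t -> characteristic_condition I J t s ->
  coef_ideal I (x - 1) -> coef_ideal J (x ^+ s - 1).
Proof.
move=> [_ nilIJ] [_ charIJ pdivs] xI; apply/coef_idealP.
rewrite raddfB /= rmorphXn rmorph1; apply/eqP; rewrite subr_eq0; apply/eqP.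
rewrite -[x in LHS](subrK 1) addrC rmorphD rmorph1.
apply: nilp_expr1D pdivs; rewrite -?rmorphXn -?raddfMn; apply/coef_idealP => h.
  exact/nilIJ/mcoeff_expr.
by apply: charIJ; exists (x - 1)@_h; [exact: xI|rewrite mcoeffMn].
Qed.

Lemma CNC_expr_prod k (N : nat -> twoSidedIdeal R) (t s : nat -> nat) x :
  CNC k N t ->
  (forall i, (1 <= i < k)%N ->
     characteristic_condition (N i) (N i.+1) (t i) (s i)) ->
  coef_ideal (N 1%N) (x - 1) -> x ^+ (\prod_(1 <= i < k) s i)%N = 1.
Proof.
move=> [k_gt0 [Nk0 _] nilN _] charN xN1.
have xN j : (1 <= j <= k)%N ->
    coef_ideal (N j) (x ^+ (\prod_(1 <= i < j) s i)%N - 1).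
  elim: j => // -[_ _|j IHj ltjk]; first by rewrite big_geq ?expr1.
  rewrite big_nat_recr //= exprM.
  apply: coef_ideal_expr (IHj (ltnW ltjk)); [exact: nilN|exact: charN].
apply/eqP; rewrite -subr_eq0; apply/eqP/malgP => h; rewrite mcoeff0.
have : [set` N k] (x ^+ (\prod_(1 <= i < k) s i)%N - 1)@_h.
  by apply: xN; rewrite k_gt0 /=.
by rewrite Nk0.
Qed.

End CoefIdeal.

(** A choice of section turns each fibre of [p] into a translate of the
    kernel. *)
Lemma card_preimage_raddf (A B : zmodType) (p : {additive A -> B}) (U : set B) :
  (forall b, exists a, p a = b) ->
  p @^-1` U #= [set a | p a = 0] `*` U.
Proof.
move=> /choice[r rK]; pose F a := (a - r (p a), p a).
have Finj : injective F by move=> a b [+ eab]; rewrite eab => /addIr.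
suff <- : F @` (p @^-1` U) = [set a | p a = 0] `*` U.
  by rewrite card_eq_sym; apply: inj_card_eq => a b _ _; apply: Finj.
apply/seteqP; split=> [_ [a Ua <-]|[a b] /= [pa0 Ub]].
  by split=> //=; rewrite raddfB rK subrr.
have pE : p (a + r b) = b by rewrite raddfD rK pa0 add0r.
by exists (a + r b); rewrite /preimage /F /= pE ?addrK.
Qed.

(** Finiteness of [G] makes every family of coefficients finitely supported,
    hence the coefficient family of an element of the group ring. *)
Lemma card_coef_ideal_setX (R : pzRingType) (G : groupType)
    (I : twoSidedIdeal R) T (U : set T) :
  finite_set [set: G] ->
  @coef_ideal R G I `*` U #= [set c : G -> R | forall h, c h \in I] `*` U.
Proof.
move=> /finite_fsetP[D DE].
have inD h : h \in D by have : [set: G] h by []; rewrite DE.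
pose F (p : group_ring R G * T) := (fun h => p.1@_h, p.2).
have Finj : injective F.
  move=> [x u] [y v] [exy ->]; congr pair; apply/malgP => h.
  exact: (congr1 (@^~ h) exy).
suff <- : F @` (@coef_ideal R G I `*` U) = [set c | forall h, c h \in I] `*` U.
  by rewrite card_eq_sym; apply: inj_card_eq => a b _ _; apply: Finj.
apply/seteqP; split=> [_ [[x u] [xI Uu] <-]//|[c u] /= [cI Uu]].
pose x : group_ring R G := [malg h in D => c h].
have xE h : x@_h = c h by rewrite mcoeffE inD.
exists (x, u); first by split=> // h /=; rewrite xE.
by rewrite /F /=; congr pair; apply/funext.
Qed.

Theorem proposition4p9 (R : pzRingType) (G : groupType) (k : nat)
    (N : nat -> twoSidedIdeal R) (t s : nat -> nat)
    (hCNC : CNC k N t)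
    (hs : forall i, (1 <= i < k)%N ->
       is_characteristic (N i) (N i.+1) (t i) (s i)) :
  [/\ (forall f : group_ring R G,
         units (group_ring (quot_ring (N 1%N)) G) (reduce (N 1%N) f) <->
         coef_coset (N 1%N) f `<=` units (group_ring R G)),
      (forall f : group_ring R G,
         units (group_ring (quot_ring (N 1%N)) G) (reduce (N 1%N) f) ->
         forall g : group_ring R G,
           reduce (N 1%N) f * reduce (N 1%N) g = 1 ->
           forall x, coef_coset (N 1%N) f x ->
             is_inverse x
               (g * (x * g) ^+ ((\prod_(1 <= i < k) s i)%N - 1))),
      (finite_set [set: G] ->
         units (group_ring R G) #=
         [set c : G -> R | forall h, c h \in N 1%N] `*`
           units (group_ring (quot_ring (N 1%N)) G))
    & (* For infinite G, |N_1|^|G| counts finitely supported functions only. *)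
      units (group_ring R G) #=
      @coef_ideal R G (N 1%N) `*` units (group_ring (quot_ring (N 1%N)) G)].
Proof.
have charN i : (1 <= i < k)%N ->
    characteristic_condition (N i) (N i.+1) (t i) (s i) by case/hs.
set S := (\prod_(1 <= i < k) s i)%N.
have S_gt0 : (0 < S)%N.
  rewrite /S big_nat_cond; apply: (big_ind (leq 1)) => // [a b|i].
    by rewrite muln_gt0 => -> ->.
  by rewrite andbT => /charN[].
have exprS_eq1 (a : group_ring R G) : reduce (N 1%N) a = 1 -> a ^+ S = 1.
  move=> a1; apply: CNC_expr_prod hCNC charN _.
  by apply/coef_idealP; rewrite raddfB /= a1 rmorph1 subrr.
have reduce_coset f x :
    coef_coset (N 1%N) f x -> reduce (N 1%N) x = reduce (N 1%N) f.
  by move=> [n /coef_idealP n0 <-]; rewrite raddfD /= n0 addr0.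
have inverse_coset f : units _ (reduce (N 1%N) f) ->
    forall g : group_ring R G, reduce (N 1%N) f * reduce (N 1%N) g = 1 ->
    forall x, coef_coset (N 1%N) f x -> is_inverse x (g * (x * g) ^+ (S - 1)).
  (* As f is a unit, its right inverse g modulo N_1 G is also a left one. *)
  move=> [q [fq qf]] g fg x /reduce_coset xf.
  have qg : q = reduce (N 1%N) g by rewrite -[q]mulr1 -fg mulrA qf mul1r.
  apply: is_inverse_expr => //; apply: exprS_eq1; rewrite rmorphM /= xf //.
  by rewrite -qg.
have units_reduce x : units (group_ring R G) x -> units _ (reduce (N 1%N) x).
  move=> [y [xy yx]]; exists (reduce (N 1%N) y).
  by split; rewrite -rmorphM /= (xy, yx) rmorph1.
have mem_coset (f : group_ring R G) : coef_coset (N 1%N) f f.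
  by exists 0; rewrite ?addr0 //; apply/coef_idealP; rewrite raddf0.
have units_coset f : units _ (reduce (N 1%N) f) ->
    coef_coset (N 1%N) f `<=` units (group_ring R G).
  move=> fu x fx; have [q [fq _]] := fu.
  have [g gq] := reduce_surj q; rewrite -gq in fq.
  by exists (g * (x * g) ^+ (S - 1)); apply: inverse_coset fq _ fx.
have unitsE : units (group_ring R G) =
    reduce (N 1%N) @^-1` units (group_ring (quot_ring (N 1%N)) G).
  by apply/seteqP; split=> x; [exact: units_reduce|move/units_coset; apply].
have card_units : units (group_ring R G) #=
    @coef_ideal R G (N 1%N) `*` units (group_ring (quot_ring (N 1%N)) G).
  have -> : @coef_ideal R G (N 1%N) = [set x | reduce (N 1%N) x = 0].
    by apply/seteqP; split=> x /coef_idealP.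
  by rewrite unitsE; apply: card_preimage_raddf; exact: reduce_surj.
split=> // [f|finG].
  by split=> [|fU]; [exact: units_coset|apply/units_reduce/fU].
exact: card_eq_trans card_units (card_coef_ideal_setX _ _ finG).
Qed.
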